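(* Let $f:\mathbb{R}^n\to\mathbb{R}$ be a directionally differentiable Lipschitz function and let $0\le k\le n-1$. Then the set $$E_k:=\{x\in\mathbb{R}^n:\gamma(f,x)=k\}$$ is $\sigma$-$k$-tangential.
   Context: $f:\mathbb{R}^n\to\mathbb{R}$ is called directionally differentiable if for every $x\in\mathbb{R}^n$ and every unit vector $\theta$ the one-sided limit $\lim_{\lambda\to0^+}\frac{f(x+\lambda\theta)-f(x)}{\lambda}$ exists (as a real number). For $A\subset\mathbb{R}^n$ let $\langle A\rangle^+$ be the set of finite combinations $\sum_i\lambda_ia_i$ with $a_i\in A$, $\lambda_i\ge0$; sets of this form are called semi-linear subspaces. In particular $\langle b\rangle^+=\{\lambda b:\lambda\ge0\}$ for $b\in\mathbb{R}^n$. For a semi-linear subspace $W$, let $\mathcal{L}(W)$ be the set of maps $L:W\to\mathbb{R}$ with $L(\lambda_1w_1+\lambda_2w_2)=\lambda_1L(w_1)+\lambda_2L(w_2)$ for all $w_1,w_2\in W$, $\lambda_1,\lambda_2\ge0$; these are exactly the restrictions to $W$ of linear functions on $\mathbb{R}^n$ (and are extended to the closure $\overline W$ accordingly). Define $$\tau(W,f,x)=\inf_{L\in\mathcal{L}(W)}\ \limsup_{w\to0,\ w\in\overline{W}}\frac{|f(x+w)-f(x)-L(w)|}{|w|}.$$ The maximal differentiability degree of $f$ at $x$ is $$\gamma(f,x)=\max\{\dim V: V\subset\mathbb{R}^n \text{ a linear subspace with } \tau(V+\langle b\rangle^+,f,x)=0\text{ for all }b\in\mathbb{R}^n\}.$$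 For a linear subspace $V\subset\mathbb{R}^n$ write each $h\in\mathbb{R}^n$ as $h=h^V+h^{V^\perp}$ with $h^V\in V$, $h^{V^\perp}\in V^\perp$. For $0\le k\le n-1$, a set $E\subset\mathbb{R}^n$ is $k$-tangential if for every $x\in E$ there is a $k$-dimensional linear subspace $V_x$ such that whenever $h_i\ne0$, $x+h_i\in E$ and $h_i\to0$ as $i\to\infty$, one has $|h_i^{V_x^\perp}|/|h_i^{V_x}|\to0$ as $i\to\infty$ (the quotient being understood as $+\infty$ if $h_i^{V_x}=0$). A set is $\sigma$-$k$-tangential if it can be covered by a countable union of $k$-tangential sets. *)

(* Defs.v *)
From HB Require Import structures.
From mathcomp Require Import all_boot all_order all_algebra.
From mathcomp Require Import all_classical all_reals all_analysis.
Import Order.TTheory GRing.Theory Num.Theory.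
Import numFieldNormedType.Exports.

Set Implicit Arguments.
Unset Strict Implicit.
Unset Printing Implicit Defensive.

Local Open Scope classical_set_scope.
Local Open Scope ring_scope.

(* The library norm on 'rV[R]_n is the sup norm, so the Euclidean structure is
   defined here; both norms induce the topology used for closures and limits. *)
Definition dotv (R : realType) (n : nat) (u v : 'rV[R]_n) : R :=
  \sum_(i < n) u 0 i * v 0 i.

Definition enorm (R : realType) (n : nat) (u : 'rV[R]_n) : R :=
  Num.sqrt (dotv u u).

Definition lipschitz_euclidean (R : realType) (n : nat) (f : 'rV[R]_n -> R) :=
  exists C : R, forall x y, `|f x - f y| <= C * enorm (x - y).

Definition directionally_differentiable (R : realType) (n : nat)
    (f : 'rV[R]_n -> R) :=
  forall x theta : 'rV[R]_n, enorm theta = 1 ->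
    exists l : R, (f (x + t *: theta) - f x) / t @[t --> 0^'+] --> l.

Definition semilinear_span (R : realType) (n : nat) (A : set 'rV[R]_n) :
    set 'rV[R]_n :=
  [set w | exists (m : nat) (l : 'I_m -> R) (a : 'I_m -> 'rV[R]_n),
     [/\ forall i, 0 <= l i, forall i, A (a i)
       & w = \sum_(i < m) l i *: a i]].

(* The values of L outside W are irrelevant. *)
Definition semilinear_on (R : realType) (n : nat) (W : set 'rV[R]_n)
    (L : 'rV[R]_n -> R) :=
  forall (w1 w2 : 'rV[R]_n) (l1 l2 : R), W w1 -> W w2 -> 0 <= l1 -> 0 <= l2 ->
    L (l1 *: w1 + l2 *: w2) = l1 * L w1 + l2 * L w2.

(* M is a linear form extending L; on closure W (a subset of the linear span
   of W) it is determined by L. At w = 0 the quotient is 0 / 0 = 0 in the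
   library; as all quotients are nonnegative, keeping the point 0 in the limsup
   changes nothing if W contains a nonzero vector, and it gives tau = 0 for
   W = {0}, where there is no nonzero w. *)
Definition tau (R : realType) (n : nat) (W : set 'rV[R]_n) (f : 'rV[R]_n -> R)
    (x : 'rV[R]_n) : \bar R :=
  ereal_inf [set t | exists (L : 'rV[R]_n -> R) (M : {scalar 'rV[R]_n}),
    [/\ semilinear_on W L, forall w, W w -> M w = L w
      & t = limf_esup
              (fun w => (`|f (x + w) - f x - M w| / enorm w)%:E)
              (within (closure W) (nbhs (0 : 'rV[R]_n)))]].

Definition add_ray (R : realType) (n : nat) (V : {vspace 'rV[R]_n})
    (b : 'rV[R]_n) : set 'rV[R]_n :=
  [set w | exists v r, [/\ v \in V, semilinear_span [set b] r & w = v + r]].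

Definition differentiability_subspace (R : realType) (n : nat)
    (f : 'rV[R]_n -> R) (x : 'rV[R]_n) (V : {vspace 'rV[R]_n}) :=
  forall b : 'rV[R]_n, tau (add_ray V b) f x = 0%E.

(* Dimensions of subspaces of R^n are at most n. For directionally
   differentiable f the zero subspace qualifies, so the maximum is never taken
   over an empty family. *)
Definition gamma (R : realType) (n : nat) (f : 'rV[R]_n -> R)
    (x : 'rV[R]_n) : nat :=
  \max_(d < n.+1 | `[< exists V : {vspace 'rV[R]_n},
                         \dim V = d /\ differentiability_subspace f x V >]) d.

Definition orthogonal_decomposition (R : realType) (n : nat)
    (V : {vspace 'rV[R]_n}) (h p q : 'rV[R]_n) :=
  [/\ p \in V, forall v, v \in V -> dotv v q = 0 & h = p + q].

Definition slope (R : realType) (n : nat) (p q : 'rV[R]_n) : \bar R :=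
  if p == 0 then +oo%E else (enorm q / enorm p)%:E.

Definition tangential (R : realType) (n : nat) (k : nat) (E : set 'rV[R]_n) :=
  forall x, E x -> exists V : {vspace 'rV[R]_n}, \dim V = k /\
    forall h p q : nat -> 'rV[R]_n,
      (forall i, h i != 0) -> (forall i, E (x + h i)) ->
      h i @[i --> \oo] --> (0 : 'rV[R]_n) ->
      (forall i, orthogonal_decomposition V (h i) (p i) (q i)) ->
      slope (p i) (q i) @[i --> \oo] --> 0%E.

Definition sigma_tangential (R : realType) (n : nat) (k : nat)
    (E : set 'rV[R]_n) :=
  exists F : nat -> set 'rV[R]_n,
    (forall i, tangential k (F i)) /\ E `<=` \bigcup_i F i.

(* Main.v *)
From HB Require Import structures.
Require Import Defs.
From mathcomp Require Import all_boot all_order all_algebra.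
From mathcomp Require Import ring lra.
From mathcomp Require Import all_classical all_reals all_analysis.
Import Order.TTheory GRing.Theory Num.Theory.
Import numFieldNormedType.Exports.

Local Open Scope classical_set_scope.
Local Open Scope ring_scope.

(* Let g = f'(x; .), which is positively homogeneous and Lipschitz. A subspace V
   satisfies tau (V + <b>^+) f x = 0 for all b iff g (v + b) = g v + g b for all
   v in V and all b. If gamma f x = k is attained by V, then no unit vector w
   orthogonal to V has this additivity, so by compactness its failure at all
   such w is detected, with definite margins, by finitely many rational test
   directions b. The pieces of the decomposition fix this finite list of tests,
   rational approximations of the values f'(x; b), and a scale below which the
   difference quotients of f along each b agree with them. For x and
   y = x + p + q in one piece, with p in V, q orthogonal to V and t = |q|
   comparable to |p + q|, computing f (y + t b) - f y from x and from y gives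
   g (p + q + t b) - g (p + q) = t g b up to a small multiple of t; the V-part p
   drops out, contradicting the test satisfied by the unit vector q / t. *)

(** * Euclidean and sup norms on row vectors, and limits from the right at 0 *)

Section row_vectors.
Context {R : realType} {n : nat}.
Implicit Types u v w : 'rV[R]_n.

Lemma coord_le_norm u (i : 'I_n) : `|u 0 i| <= `|u|.
Proof.
rewrite [leRHS]/Num.norm /= mx_normrE; apply/bigmax_geP; right => /=.
by exists (0, i).
Qed.

Lemma dotvv_ge0 u : 0 <= dotv u u.
Proof. by apply: sumr_ge0 => i _; rewrite -expr2 sqr_ge0. Qed.

Lemma dotvDr u v w : dotv u (v + w) = dotv u v + dotv u w.
Proof. by rewrite /dotv -big_split; apply: eq_bigr => i _; rewrite mxE mulrDr. Qed.

Lemma dotvZr (a : R) u v : dotv u (a *: v) = a * dotv u v.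
Proof. by rewrite /dotv big_distrr; apply: eq_bigr => i _; rewrite mxE mulrCA. Qed.

Lemma dotvC u v : dotv u v = dotv v u.
Proof. by apply: eq_bigr => i _; rewrite mulrC. Qed.

Lemma enorm_ge0 u : 0 <= enorm u.
Proof. exact: sqrtr_ge0. Qed.

Lemma enormZ (a : R) u : enorm (a *: u) = `|a| * enorm u.
Proof.
rewrite /enorm dotvZr dotvC dotvZr mulrA -expr2 sqrtrM ?sqr_ge0 //.
by rewrite sqrtr_sqr.
Qed.

Lemma norm_le_enorm u : `|u| <= enorm u.
Proof.
rewrite {1}/Num.norm /= mx_normrE; apply/bigmax_leP; split; first exact: enorm_ge0.
move=> [i j] _ /=; rewrite (ord1 i) -sqrtr_sqr ler_wsqrtr //.
rewrite /dotv (bigD1 j) //= -expr2 lerDl.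
by apply: sumr_ge0 => l _; rewrite -expr2 sqr_ge0.
Qed.

(** Each of the n squares is at most the squared sup norm, and [n <= n ^ 2] gives the crude factor n
    in place of its square root. *)
Lemma enorm_le_norm u : enorm u <= n%:R * `|u|.
Proof.
have nu0 : 0 <= n%:R * `|u| by rewrite mulr_ge0.
rewrite -[leRHS]ger0_norm // -sqrtr_sqr ler_wsqrtr //.
apply: (@le_trans _ _ (\sum_(i < n) `|u| ^+ 2)).
  apply: ler_sum => i _; rewrite -expr2 -real_normK ?num_real //.
  by rewrite lerXn2r ?nnegrE // coord_le_norm.
rewrite sumr_const card_ord exprMn -[leLHS]mulr_natl. rewrite ler_wpM2r ?sqr_ge0 //.
by rewrite -natrX ler_nat; case: (n) => // m; rewrite leq_pmulr.
Qed.

Lemma enorm_eq0 u : (enorm u == 0) = (u == 0).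
Proof.
apply/eqP/eqP => [u0|->]; last first.
  by apply/eqP; rewrite eq_le enorm_ge0 (le_trans (enorm_le_norm _)) // normr0 mulr0.
by apply/eqP; rewrite -normr_le0 -u0 norm_le_enorm.
Qed.

Lemma enorm0 : enorm (0 : 'rV[R]_n) = 0.
Proof. by apply/eqP; rewrite enorm_eq0. Qed.

Lemma dotvv_eq0 u : (dotv u u == 0) = (u == 0).
Proof. by rewrite -enorm_eq0 /enorm sqrtr_eq0 eq_le dotvv_ge0 andbT. Qed.

Lemma enorm_orthogonal_le u v : dotv u v = 0 -> enorm v <= enorm (u + v).
Proof.
move=> uv; rewrite ler_wsqrtr // dotvDr !(dotvC (u + v)) !dotvDr (dotvC v u) uv.
by rewrite addr0 add0r lerDr dotvv_ge0.
Qed.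

Lemma scalar_bounded (M : {scalar 'rV[R]_n}) :
  exists2 K, 0 <= K & forall u, `|M u| <= K * `|u|.
Proof.
exists (\sum_(i < n) `|M (delta_mx 0 i)|); first exact: sumr_ge0.
move=> u; rewrite {1}(row_sum_delta u) linear_sum mulr_suml.
apply: le_trans (ler_norm_sum _ _ _) _; apply: ler_sum => i _.
by rewrite linearZ /= normrM mulrC ler_wpM2l // coord_le_norm.
Qed.

Lemma lipschitz_continuous (h : 'rV[R]_n -> R) (K : R) :
  (forall u v, `|h u - h v| <= K * `|u - v|) -> continuous h.
Proof.
move=> hK u; apply/(@cvgrPdist_le _ _ _ _ (nbhs_filter u)) => /= e e0; near=> v.
apply: le_trans (hK u v) _.
(* [K] may be zero or negative, hence the divisor [|K| + 1]. *)
have K1 : 0 < `|K| + 1 by rewrite ltr_wpDl.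
have : `|u - v| <= e / (`|K| + 1).
  near: v; apply/nbhs_ballP; exists (e / (`|K| + 1)); first by rewrite /= divr_gt0.
  by move=> v; rewrite -ball_normE => /ltW.
rewrite ler_pdivlMr // mulrC; apply: le_trans.
by rewrite ler_wpM2r // (le_trans (ler_norm K)) // lerDl.
Unshelve. all: by end_near. Qed.

Lemma closed_eq0 (h : 'rV[R]_n -> R) : continuous h -> closed [set u | h u = 0].
Proof.
by move=> hc; apply: (closed_comp (f := h) (D := [set 0])) => [u _|]; [exact: hc|exact: closed_eq].
Qed.

Lemma near_at_right0 (P : R -> Prop) :
  (\forall t \near 0^'+, P t) <-> exists2 d, 0 < d & forall t, 0 < t < d -> P t.
Proof.
split=> [/nbhs_ballP[d /= d0 dP]|[d d0 dP]].
  exists d => // t /andP[t0 td]; apply: dP => //=.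
  by rewrite /ball /= sub0r normrN gtr0_norm.
near=> t; apply: dP; apply/andP; split; near: t; first exact: nbhs_right_gt.
exact: nbhs_right_lt.
Unshelve. all: by end_near. Qed.

End row_vectors.

(** * One-sided directional derivatives of a Lipschitz function *)

Definition ddir (R : realType) (n : nat) (f : 'rV[R]_n -> R) (x v : 'rV[R]_n) : R :=
  lim ((f (x + t *: v) - f x) / t @[t --> 0^'+]).

Arguments ddir {R n} f x v.

Section directional_derivative.
Context {R : realType} {n : nat} {f : 'rV[R]_n -> R} {C : R}.
Hypothesis C0 : 0 < C.
Hypothesis lip_f : forall x y, `|f x - f y| <= C * `|x - y|.
Hypothesis dd_f : directionally_differentiable f.
Implicit Types x v w : 'rV[R]_n.
Local Notation g := (ddir f).

(** Limits are assumed along unit vectors only. The substitution [t * enorm v] extends them to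
    nonzero [v], and at [v = 0] the quotient vanishes; so the [lim] in [ddir] is a true limit. *)
Lemma near_ddir x v e : 0 < e ->
  \forall t \near 0^'+, `|f (x + t *: v) - f x - t * g x v| <= e * t.
Proof.
move=> e0.
suff /cvgrPdist_le/(_ e e0) H : (f (x + t *: v) - f x) / t @[t --> 0^'+] --> g x v.
  near=> t.
  have t0 : 0 < t by near: t; exact: nbhs_right_gt.
  have : `|g x v - (f (x + t *: v) - f x) / t| <= e by near: t.
  rewrite -(ler_pM2r t0); apply: le_trans.
  rewrite -[X in _ <= _ * X](gtr0_norm t0) -normrM mulrBl divfK ?gt_eqF // distrC.
  by rewrite (mulrC _ t).
suff [l Hl] : exists l : R, (f (x + t *: v) - f x) / t @[t --> 0^'+] --> l.
  by rewrite /ddir (cvg_lim _ Hl).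
have [->|v0] := eqVneq v 0.
  exists 0; apply: (@cvg_trans _ (cst (0 : R) @ 0^'+)); last exact: cvg_cst.
  by apply: near_eq_cvg; near=> t; rewrite scaler0 addr0 subrr mul0r.
pose s := enorm v.
have s0 : 0 < s by rewrite lt_def enorm_ge0 enorm_eq0 v0.
have [|l Hl] := @dd_f x (s^-1 *: v).
  by rewrite enormZ gtr0_norm ?invr_gt0 // mulVf // gt_eqF.
exists (s * l); apply/cvgrPdist_le => e' e'0.
move/cvgrPdist_le : Hl => /(_ (e' / s)); rewrite divr_gt0 // => /(_ isT).
move=> /near_at_right0[d d0 Hd]; apply/near_at_right0; exists (d / s) => [|t /andP[t0 td]].
  by rewrite divr_gt0.
have /Hd : 0 < t * s < d by rewrite mulr_gt0 //= -ltr_pdivlMr.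
rewrite scalerA mulfK ?gt_eqF // -(ler_pM2l s0) -{1}(gtr0_norm s0) -normrM.
rewrite mulrBr [s * (e' / s)]mulrC divfK ?gt_eqF //.
by rewrite [s * (_ / _)]mulrC -mulrA invfM -mulrA mulVf ?mulr1 ?gt_eqF.
Unshelve. all: by end_near. Qed.

Lemma ddirZ x v (a : R) : 0 <= a -> g x (a *: v) = a * g x v.
Proof.
rewrite le_eqVlt => /predU1P[<-|a0].
  rewrite scale0r mul0r; apply/eqP; rewrite -normr_le0; apply/ler_addgt0Pl => e e0.
  have /near_at_right0[d d0 /(_ (d / 2))] := @near_ddir x 0 e e0.
  rewrite divr_gt0 // ltr_pdivrMr // ltr_pMr // ltr1n => /(_ isT).
  rewrite scaler0 addr0 subrr sub0r normrN normrM gtr0_norm ?divr_gt0 //.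
  by rewrite mulrC ler_pM2r ?divr_gt0 // addr0.
apply/eqP; rewrite -subr_eq0 -normr_le0; apply/ler_addgt0Pl => e e0; rewrite addr0.
have e20 : 0 < e / 2 by rewrite divr_gt0.
have /near_at_right0[d d0 Hd] := @near_ddir x (a *: v) _ e20.
have e2a : 0 < e / 2 / a by rewrite divr_gt0.
have /near_at_right0[d' d'0 Hd'] := @near_ddir x v _ e2a.
(* Small enough for [t] along [a *: v] and for [t * a] along [v], which reach the same point. *)
pose t := Num.min d (d' / a) / 2.
have m0 : 0 < Num.min d (d' / a) by rewrite lt_min d0 divr_gt0.
have t0 : 0 < t by rewrite divr_gt0.
have tm : t < Num.min d (d' / a) by rewrite /t ltr_pdivrMr // ltr_pMr // ltr1n.
have /Hd H1 : 0 < t < d by rewrite t0 (lt_le_trans tm) // ge_min lexx.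
have /Hd' H2 : 0 < t * a < d'.
  by rewrite mulr_gt0 // -ltr_pdivlMr // (lt_le_trans tm) // ge_min lexx orbT.
rewrite -(ler_pM2l t0) -{1}(gtr0_norm t0) -normrM.
rewrite scalerA in H1.
have -> : t * (g x (a *: v) - a * g x v) =
  (f (x + (t * a) *: v) - f x - t * a * g x v) -
  (f (x + (t * a) *: v) - f x - t * g x (a *: v)) by ring.
apply: le_trans (ler_normB _ _) _; apply: le_trans (lerD H2 H1) _.
have -> : e / 2 / a * (t * a) = e / 2 * t by rewrite [t * a]mulrC mulrA divfK // gt_eqF.
by rewrite le_eqVlt -mulrDl -splitr mulrC eqxx.
Qed.

Lemma ddir0 x : g x 0 = 0.
Proof. by rewrite -(scale0r 0) ddirZ // mul0r. Qed.

Lemma ddir_lipschitz x v w : `|g x v - g x w| <= C * `|v - w|.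
Proof.
apply/ler_addgt0Pl => e e0.
have e20 : 0 < e / 2 by rewrite divr_gt0.
have Hv := @near_ddir x v _ e20; have Hw := @near_ddir x w _ e20.
have [d d0 /(_ (d / 2))] := (near_at_right0 _).1 (filterI Hv Hw).
rewrite divr_gt0 // ltr_pdivrMr // ltr_pMr // ltr1n => /(_ isT).
have : 0 < d / 2 by rewrite divr_gt0.
move: (d / 2) => t t0 [H1 H2].
rewrite -(ler_pM2l t0) -{1}(gtr0_norm t0) -normrM.
have -> : t * (g x v - g x w) = (f (x + t *: v) - f (x + t *: w))
   - (f (x + t *: v) - f x - t * g x v) + (f (x + t *: w) - f x - t * g x w) by ring.
apply: le_trans (ler_normD _ _) _; apply: le_trans (lerD (ler_normB _ _) H2) _.
apply: le_trans (lerD (lerD (lip_f _ _) H1) (lexx _)) _.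
rewrite opprD addrACA subrr add0r -scalerBr normrZ gtr0_norm //.
rewrite le_eqVlt; apply/orP; left; apply/eqP; by field.
Qed.

(** Compactness of the ball in near-covering form: the estimate at [v] passes to nearby [v'] because
    [f] and [g x] are both Lipschitz, with three errors of at most [e / 3 * t]. *)
Lemma near_ddir_uniform x (K e : R) : 0 < e ->
  \forall t \near 0^'+, forall v, `|v| <= K ->
    `|f (x + t *: v) - f x - t * g x v| <= e * t.
Proof.
move=> e0.
have cK : compact [set v : 'rV[R]_n | `|v| <= K].
  apply: bounded_closed_compact.
    by exists K; split; [exact: num_real|move=> M KM v /= /le_trans; apply; exact: ltW].
  apply: (closed_comp (f := fun v : 'rV[R]_n => `|v|) (D := [set r : R | r <= K])).
    by move=> v _; exact: norm_continuous.
  exact: closed_le.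
apply: ((compact_near_coveringP _).1 cK R 0^'+
  (fun t v => `|f (x + t *: v) - f x - t * g x v| <= e * t)) => v _.
have e30 : 0 < e / 3 by rewrite divr_gt0.
have [d d0 Hd] := (near_at_right0 _).1 (@near_ddir x v _ e30).
near=> v' t => /=.
have t0 : 0 < t by near: t; exact: nbhs_right_gt.
have td : t < d by near: t; exact: nbhs_right_lt.
have vv' : C * `|v' - v| <= e / 3.
  rewrite mulrC -ler_pdivlMr // distrC; near: v'; apply/nbhs_ballP.
  exists (e / 3 / C); first by rewrite /= divr_gt0.
  by move=> w; rewrite -ball_normE => /ltW.
have /Hd Htv : 0 < t < d by rewrite t0.
have -> : f (x + t *: v') - f x - t * g x v' = (f (x + t *: v') - f (x + t *: v))
  + t * (g x v - g x v') + (f (x + t *: v) - f x - t * g x v) by ring.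
apply: le_trans (ler_normD _ _) _; apply: le_trans (lerD (ler_normD _ _) Htv) _.
rewrite normrM gtr0_norm //.
have H1 : `|f (x + t *: v') - f (x + t *: v)| <= e / 3 * t.
  apply: le_trans (lip_f _ _) _.
  rewrite opprD addrACA subrr add0r -scalerBr normrZ gtr0_norm // mulrCA mulrC.
  by rewrite ler_pM2r.
have H2 : t * `|g x v - g x v'| <= e / 3 * t.
  by rewrite mulrC ler_pM2r // (le_trans (ddir_lipschitz _ _ _)) // distrC.
have -> : e * t = e / 3 * t + e / 3 * t + e / 3 * t by field.
by rewrite lerD2r lerD.
Unshelve. all: by end_near. Qed.

End directional_derivative.

(** * Rays added to subspaces, and additive directions of positively homogeneous functions *)

Lemma capv_vline0 (K : fieldType) (vT : vectType K) (V : {vspace vT}) (b : vT) :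
  b \notin V -> (V :&: <[b]> = 0)%VS.
Proof.
move=> bV; apply/eqP; rewrite -subv0; apply/subvP => w.
rewrite memv_cap => /andP[wV /vlineP[c wE]]; rewrite memv0 wE scaler_eq0.
apply: contraR bV; rewrite negb_or => /andP[c0 _].
by rewrite -(scalerK c0 b) -wE memvZ.
Qed.

Lemma add_rayP (R : realType) (n : nat) (V : {vspace 'rV[R]_n}) (b w : 'rV[R]_n) :
  add_ray V b w <-> exists v r, [/\ v \in V, 0 <= r & w = v + r *: b].
Proof.
split=> [[v [_ [vV [m [l [a [l0 ab ->]]]] ->]]]|[v [r [vV r0 ->]]]].
  exists v, (\sum_i l i); split => //; first exact: sumr_ge0.
  by rewrite scaler_suml; congr (_ + _); apply: eq_bigr => i _; rewrite ab.
exists v, (r *: b); split => //; exists 1, (fun=> r), (fun=> b); split => //.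
by rewrite big_ord1.
Qed.

(** For positively homogeneous real [g] these [v] form a linear subspace on which [g] is linear;
    this describes differentiability subspaces without the infimum in [tau]. *)
Definition additive_at (U : zmodType) (T : zmodType) (g : U -> T) (v : U) :=
  forall b, g (v + b) = g v + g b.
Arguments additive_at {U T} g v.

Section additive_directions.
Context {R : realType} {U : lmodType R} {g : U -> R}.
Hypothesis gZ : forall v (a : R), 0 <= a -> g (a *: v) = a * g v.
Implicit Types v w : U.

Let g0 : g 0 = 0.
Proof. by rewrite -(scale0r 0) gZ // mul0r. Qed.

(** Splitting [b] as [(b - v) + v] turns additivity at [v] into additivity at [- v]. *)
Lemma additive_atN v : additive_at g v -> additive_at g (- v).
Proof.
move=> gv.
have gN : g (- v) = - g v by apply/eqP; rewrite -addr_eq0 addrC -gv subrr g0.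
by move=> b; rewrite gN -[b in RHS](addrNK v) addrC [b - v + v]addrC gv addKr.
Qed.

Lemma additive_atD v w : additive_at g v -> additive_at g w -> additive_at g (v + w).
Proof. by move=> gv gw b; rewrite -addrA !gv gw addrA. Qed.

(** For [a > 0], factor [a v + b = a (v + b / a)]; a negative [a] is [- a] acting on [- v]. *)
Lemma additive_atZ v (a : R) : additive_at g v -> additive_at g (a *: v).
Proof.
wlog a0 : v a / 0 <= a => [H gv|gv b].
  have [/H|/ltW a0] := leP 0 a; first exact.
  by rewrite -[a]opprK scaleNr -scalerN; apply: H; [rewrite oppr_ge0|exact: additive_atN].
move: a0; rewrite le_eqVlt => /predU1P[<-|a0]; first by rewrite scale0r add0r g0 add0r.
rewrite -[in LHS](scalerKV (lt0r_neq0 a0) b) -scalerDr (gZ (v + _)) ?ltW // gv mulrDr.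
by rewrite -!gZ ?ltW // scalerKV ?gt_eqF.
Qed.

(** Homogeneity extends to [a < 0]: [a v] and [- a v] add up to 0, where [g] vanishes. *)
Lemma additive_at_scale v (a : R) : additive_at g v -> g (a *: v) = a * g v.
Proof.
move=> gv; have [a0|/ltW a0] := leP 0 a; first exact: gZ.
have := additive_atZ v (- a) gv (a *: v).
rewrite -scalerDl addNr scale0r g0 (gZ v (- a)) ?oppr_ge0 // mulNr addrC => /eqP.
by rewrite eq_sym subr_eq0 => /eqP.
Qed.

End additive_directions.

(** * Differentiability subspaces as subspaces of additive directions *)

Section differentiability_subspaces.
Context {R : realType} {n : nat} {f : 'rV[R]_n -> R} {C : R}.
Hypothesis C0 : 0 < C.
Hypothesis lip_f : forall x y, `|f x - f y| <= C * `|x - y|.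
Hypothesis dd_f : directionally_differentiable f.
Implicit Types (x v w b : 'rV[R]_n) (V : {vspace 'rV[R]_n}).
Local Notation g := (ddir f).

Let gZ x v a : 0 <= a -> g x (a *: v) = a * g x v := ddirZ dd_f x v a.

(** The infimum in [tau] need not be attained, so [M] depends on [e]. Evaluation at a small
    [t *: w], divided by [t], costs [e * enorm w] from [tau] and [e] from the directional
    derivative. *)
Lemma tau_eq0_approx x V b e : tau (add_ray V b) f x = 0%E -> 0 < e ->
  exists M : {scalar 'rV[R]_n},
    forall w, add_ray V b w -> `|g x w - M w| <= e * (enorm w + 1).
Proof.
move=> tau0 e0.
have : (tau (add_ray V b) f x < e%:E)%E by rewrite tau0 lte_fin.
move=> /ereal_inf_lt[_ [L [M [_ _ ->]]]] /ereal_inf_lt[_ [A nA <-]] supA.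
exists M => w Ww.
have [d d0 dA] := (nbhs_ballP _ _).1 nA.
have w1 : 0 < `|w| + 1 by rewrite ltr_wpDl.
have [d' d'0 Hd'] := (near_at_right0 _).1 (@near_ddir _ _ _ dd_f x w _ e0).
(* Below [d'] for the directional derivative, and with [t * (|w| + 1) < d] so that [t *: w] is in
   the ball. *)
pose t := Num.min d' (d / (`|w| + 1)) / 2.
have m0 : 0 < Num.min d' (d / (`|w| + 1)) by rewrite lt_min d'0 divr_gt0.
have t0 : 0 < t by rewrite divr_gt0.
have tm : t < Num.min d' (d / (`|w| + 1)) by rewrite /t ltr_pdivrMr // ltr_pMr // ltr1n.
have /Hd' H1 : 0 < t < d' by rewrite t0 (lt_le_trans tm) // ge_min lexx.
have td : t * (`|w| + 1) < d.
  by rewrite -ltr_pdivlMr // (lt_le_trans tm) // ge_min lexx orbT.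
have At : A (t *: w).
  apply: dA.
    rewrite -ball_normE /= sub0r normrN normrZ gtr0_norm //.
    by rewrite (le_lt_trans _ td) // ler_pM2l // lerDl.
  apply: subset_closure; move/add_rayP : Ww => [v [r [vV r0 ->]]]; apply/add_rayP.
  by exists (t *: v), (t * r); rewrite memvZ // (mulr_ge0 (ltW t0) r0) scalerDr scalerA.
have H2 : `|f (x + t *: w) - f x - M (t *: w)| <= e * enorm (t *: w).
  have [->|w0] := eqVneq w 0.
    by rewrite scaler0 addr0 subrr linear0 subrr normr0 mulr_ge0 ?enorm_ge0 ?ltW.
  rewrite -ler_pdivrMr; last first.
    by rewrite lt_def enorm_ge0 enorm_eq0 scaler_eq0 negb_or (gt_eqF t0) w0.
  rewrite -lee_fin; apply: le_trans (ltW supA).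
  by apply: ereal_sup_ubound; exists (t *: w).
rewrite -(ler_pM2l t0) -{1}(gtr0_norm t0) -normrM.
rewrite linearZ /= in H2.
have -> : t * (g x w - M w) = (f (x + t *: w) - f x - t * M w)
  - (f (x + t *: w) - f x - t * g x w) by ring.
apply: le_trans (ler_normB _ _) _; apply: le_trans (lerD H2 H1) _.
by rewrite enormZ gtr0_norm // mulrDr mulr1 mulrDr mulrCA (mulrC e t).
Qed.

(** [v + b], [v] and [b] all lie in [add_ray V b], where the linear [M] is close to [g x]; the three
    errors are normalised by [K] to total [e]. *)
Lemma differentiability_subspace_additive x V v :
  differentiability_subspace f x V -> v \in V -> additive_at (g x) v.
Proof.
move=> HV vV b; apply/eqP; rewrite -subr_eq0 -normr_le0; apply/ler_addgt0Pl => e e0.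
pose K := enorm (v + b) + 1 + (enorm v + 1) + (enorm b + 1).
have K0 : 0 < K.
  by rewrite /K; have := enorm_ge0 (v + b); have := enorm_ge0 v; have := enorm_ge0 b; lra.
have eK : 0 < e / K by rewrite divr_gt0.
have [M HM] := tau_eq0_approx x V b _ (HV b) eK.
have H1 : add_ray V b (v + b) by apply/add_rayP; exists v, 1; rewrite scale1r.
have H2 : add_ray V b v by apply/add_rayP; exists v, 0; rewrite scale0r addr0.
have H3 : add_ray V b b by apply/add_rayP; exists 0, 1; rewrite mem0v scale1r add0r.
have -> : g x (v + b) - (g x v + g x b) =
  (g x (v + b) - M (v + b)) - (g x v - M v) - (g x b - M b).
  by rewrite linearD /=; ring.
apply: le_trans (ler_normB _ _) _; apply: le_trans (lerD (ler_normB _ _) (lexx _)) _.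
apply: le_trans (lerD (lerD (HM _ H1) (HM _ H2)) (HM _ H3)) _.
by rewrite -!mulrDr -/K addr0 divfK // gt_eqF.
Qed.

Lemma additive_scalar_ext x V b : (forall v, v \in V -> additive_at (g x) v) ->
  exists M : {scalar 'rV[R]_n}, forall w, add_ray V b w -> M w = g x w.
Proof.
(* If [b] lies in [V], the ray adds nothing and is replaced by the ray of 0. *)
wlog Vb0 : b / (V :&: <[b]> = 0)%VS.
  move=> H HV; have [bV|/capv_vline0 Vb0] := boolP (b \in V); last exact: H.
  have line0 : (<[0 : 'rV[R]_n]> = 0)%VS by apply/eqP; rewrite -dimv_eq0 dim_vline eqxx.
  have [|//|M HM] := H 0; first by rewrite line0 capv0.
  exists M => w /add_rayP[v [r [vV r0 ->]]]; apply: HM; apply/add_rayP.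
  by exists (v + r *: b), 0; rewrite scaler0 addr0 memvD // memvZ.
move=> HV.
(* Apply [g x] to the projection on [V], and extend linearly along the line of [b]. At [b = 0] the
   coefficient is 0 / 0 = 0, consistent with [g x 0 = 0]. *)
pose h u := g x (daddv_pi V <[b]> u) + dotv b (daddv_pi <[b]> V u) / dotv b b * g x b.
have h_lin : linear_for *%R h.
  move=> a u v; rewrite /h !linearP /=.
  have pV w : daddv_pi V <[b]> w \in V by exact: memv_pi.
  rewrite (additive_atZ (gZ x) _ _ (HV _ (pV u))).
  rewrite (additive_at_scale (gZ x)); last exact: HV.
  by rewrite dotvDr dotvZr; ring.
pose M : {scalar 'rV[R]_n} := HB.pack h (GRing.isLinear.Build R 'rV[R]_n R *%R h h_lin).
exists M => w /add_rayP[v [r [vV r0 ->]]].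
have bV0 : (<[b]> :&: V = 0)%VS by rewrite capvC.
have rb : r *: b \in <[b]>%VS by rewrite memvZ // memv_line.
have pib : daddv_pi V <[b]> (r *: b) = 0.
  have := daddv_pi_add Vb0 (subvP (addvSr V <[b]>) _ rb).
  by rewrite (daddv_pi_id bV0 rb) -[RHS]add0r => /addIr.
have piv : daddv_pi <[b]> V v = 0.
  have := daddv_pi_add Vb0 (subvP (addvSl V <[b]>) _ vV).
  by rewrite (daddv_pi_id Vb0 vV) -[RHS]addr0 => /addrI.
rewrite /M /= /h !linearD /= pib piv addr0 add0r (daddv_pi_id Vb0 vV).
rewrite (daddv_pi_id bV0 rb) (HV _ vV) dotvZr gZ //; congr (_ + _).
have [->|b0] := eqVneq b 0; first by rewrite ddir0 ?mulr0.
by rewrite mulfK // dotvv_eq0.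
Qed.

(** On [V + <b>^+] the function [g x] is the restriction of a linear [M], and the uniform estimate
    on the unit ball makes the remainder small relative to [|w|]. *)
Lemma additive_differentiability_subspace x V :
  (forall v, v \in V -> additive_at (g x) v) -> differentiability_subspace f x V.
Proof.
move=> HV b.
have [M HM] := additive_scalar_ext x V b HV.
have W0 : add_ray V b 0.
  by apply/add_rayP; exists 0, 0; rewrite mem0v scale0r add0r.
apply/eqP; rewrite eq_le; apply/andP; split; last first.
  (* The point 0 of the closure keeps the filter proper, so a limsup of nonnegative quotients is
     nonnegative. *)
  apply: le_ereal_inf_tmp => _ [L [N [_ _ ->]]]; apply: limf_esup_ge0.
    move=> /nbhs_ballP[d d0 /(_ 0)] []; first exact: ballxx.
    exact: subset_closure.
  by move=> w; rewrite lee_fin divr_ge0 // enorm_ge0.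
apply/lee_addgt0Pr => e e0; rewrite add0e.
pose q w : \bar R := (`|f (x + w) - f x - M w| / enorm w)%:E.
apply: (@le_trans _ (\bar R) (limf_esup q (within (closure (add_ray V b)) (nbhs (0 : 'rV[R]_n))))).
  apply: ereal_inf_lbound; exists (g x), M; split => //.
  move=> w1 w2 l1 l2 Ww1 Ww2 l10 l20; rewrite -!HM ?linearP ?linearD ?linearZ //.
  move: Ww1 Ww2 => /add_rayP[v1 [r1 [v1V r10 ->]]] /add_rayP[v2 [r2 [v2V r20 ->]]].
  apply/add_rayP; exists (l1 *: v1 + l2 *: v2), (l1 * r1 + l2 * r2).
  rewrite memvD ?memvZ // addr_ge0 ?mulr_ge0 //; split => //.
  by rewrite !scalerDr addrACA !scalerA scalerDl.
have Mg w : closure (add_ray V b) w -> M w = g x w.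
  move=> clw; apply/eqP; rewrite -subr_eq0; apply/eqP.
  have [K K0 MK] := scalar_bounded M.
  have cM : continuous (fun w => M w - g x w).
    apply: (@lipschitz_continuous _ _ _ (K + C)) => u v.
    have -> : M u - g x u - (M v - g x v) = M (u - v) - (g x u - g x v).
      by rewrite linearB /=; ring.
    rewrite mulrDl (le_trans (ler_normB _ _)) // lerD // ?MK //.
    exact: ddir_lipschitz.
  have /closure_id := closed_eq0 _ cM => clE.
  have : closure [set w | M w - g x w = 0] w.
    by apply: closure_subset clw => u /HM Mu /=; rewrite Mu subrr.
  by rewrite -clE.
have [d d0 Hd] := (near_at_right0 _).1 (near_ddir_uniform C0 lip_f dd_f x 1 _ e0).
apply: (@le_trans _ _ (ereal_sup (q @` [set w | q w <= e%:E]%E))); last first.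
  by apply: ge_ereal_sup => _ [w /= qw <-].
apply: ereal_inf_lbound; exists [set w | q w <= e%:E]%E => //.
apply/nbhs_ballP; exists d => // w; rewrite -ball_normE /= sub0r normrN => wd clw.
rewrite /q lee_fin; have [->|w0] := eqVneq w 0.
  by rewrite addr0 subrr linear0 subrr normr0 mul0r ltW.
have nw0 : 0 < `|w| by rewrite normr_gt0.
rewrite ler_pdivrMr; last by rewrite lt_def enorm_ge0 enorm_eq0 w0.
(* The uniform estimate is used at the unit vector [w / |w|] and the scale [t = |w|]. *)
have /Hd/(_ (`|w|^-1 *: w)) : 0 < `|w| < d by rewrite nw0.
rewrite normrZ normfV normr_id mulVf ?gt_eqF // lexx => /(_ isT).
rewrite -gZ ?normr_ge0 // scalerA divff ?gt_eqF // scale1r -Mg // => /le_trans; apply.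
by rewrite ler_pM2l // norm_le_enorm.
Qed.

(** [V] attains the maximum. A nonzero additive [w] orthogonal to it is outside [V], so [V + <[w]>]
    would be a differentiability subspace of dimension [k + 1], at most n. *)
Lemma gamma_eq_subspace x k : gamma f x = k -> (k < n)%N ->
  exists V, [/\ \dim V = k, forall v, v \in V -> additive_at (g x) v
    & forall w, (forall v, v \in V -> dotv v w = 0) -> additive_at (g x) w -> w = 0].
Proof.
move=> gk kn.
have [V [dV HV]] : exists V, \dim V = k /\ differentiability_subspace f x V.
  rewrite -gk /gamma.
  pose P := fun d : 'I_n.+1 => `[< exists V : {vspace 'rV[R]_n},
                         \dim V = d /\ differentiability_subspace f x V >].
  have P0 : P ord0.
    apply/asboolP; exists 0%VS; rewrite dimv0; split => //.
    apply: additive_differentiability_subspace => v; rewrite memv0 => /eqP -> b.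
    by rewrite add0r ddir0 // add0r.
  have [|i /asboolP Pi ->] := @eq_bigmax_cond _ P (fun d => d : nat); last exact: Pi.
  by apply/card_gt0P; exists ord0.
have Vadd v : v \in V -> additive_at (g x) v by exact: differentiability_subspace_additive.
exists V; split => // w wV gw; apply/eqP; apply/negPn/negP => w0.
have wV' : w \notin V.
  apply: contra w0 => /wV ww; by rewrite -dotvv_eq0 ww.
suff : (k < gamma f x)%N by rewrite gk ltnn.
have := @bigop.bigmax_sup _ (Ordinal (kn : (k.+1 < n.+1)%N)); rewrite /gamma; apply => //.
apply/asboolP; exists (V + <[w]>)%VS; split.
  by rewrite dimv_disjoint_sum ?capv_vline0 // dV dim_vline w0 addn1.
apply: additive_differentiability_subspace => _ /memv_addP[v vV [_ /vlineP[c ->] ->]].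
by apply: additive_atD; [exact: Vadd|exact: (additive_atZ (gZ x))].
Qed.

End differentiability_subspaces.

(** * Finitely many simultaneous conditions, rational directions and the additivity defect *)

Lemma near_seq_all (T : Type) (I : eqType) (F : set_system T) (s : seq I)
    (P : I -> T -> Prop) : Filter F ->
  (forall i, i \in s -> \forall t \near F, P i t) ->
  \forall t \near F, forall i, i \in s -> P i t.
Proof.
move=> FF; elim: s => [_|i s IHs Hs]; first by apply: nearW => t i; rewrite in_nil.
have Hi : \forall t \near F, P i t by apply: Hs; rewrite mem_head.
have {}IHs := IHs (fun j js => Hs j (mem_behead (s := i :: s) js)).
by apply: filterS2 Hi IHs => t Pi Ps j; rewrite in_cons => /predU1P[->|/Ps].
Qed.

Lemma rat_row_approx (R : realType) (n : nat) (u : 'rV[R]_n) (e : R) : 0 < e ->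
  exists B : 'rV[rat]_n, `|u - map_mx ratr B| <= e.
Proof.
move=> e0.
have /boolp.choice[F HF] : forall i, exists q, `|u 0 i - ratr q| <= e.
  move=> i.
  have [|q] := @rat_in_itvoo R (u 0 i - e) (u 0 i + e); first lra.
  by rewrite in_itv /= => /andP[q1 q2]; exists q; rewrite ler_norml; apply/andP; split; lra.
exists (\row_i F i); rewrite {1}/Num.norm /= mx_normrE; apply/bigmax_leP.
by split=> [|[i j] _ /=]; [exact: ltW|rewrite (ord1 i) !mxE].
Qed.

Definition defect (U : zmodType) (R : numDomainType) (g : U -> R) (w b : U) : R :=
  `|g (w + b) - g w - g b|.
Arguments defect {U R} g w b.

(** Here [F], [A], [B], [D] are the values of f at [x], [x + h], [x + h + t b], [x + t b]; [G1],
    [G2], [G3] are the matching derivatives, and [Q] is the rational test value. [Q] cancels between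
    [x] and [x + h], and the errors sum to [7/2 * T * t]. *)
Lemma second_difference_bound (R : realFieldType) (t T F A B D G1 G2 G3 Q : R) :
  0 < T -> 0 < t ->
  `|A - F - t * G1| <= T / 2 * t -> `|B - F - t * G2| <= T / 2 * t ->
  `|D - F - t * G3| <= T / 2 * t -> `|D - F - t * Q| <= T * t ->
  `|B - A - t * Q| <= T * t -> `|t * (G2 - G1 - G3)| <= t * (4 * T).
Proof.
move=> T0 t0 H1 H2 H3 H4 H5.
have -> : t * (G2 - G1 - G3) = (A - F - t * G1) - (B - F - t * G2)
  + (D - F - t * G3) - (D - F - t * Q) + (B - A - t * Q) by ring.
apply: le_trans (ler_normD _ _) (le_trans (lerD _ H5) _).
  apply: le_trans (ler_normB _ _) (lerD _ H4).
  apply: le_trans (ler_normD _ _) (lerD _ H3).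
  exact: le_trans (ler_normB _ _) (lerD H1 H2).
by have := mulr_gt0 T0 t0; lra.
Qed.

(** * The countable decomposition into tangential pieces *)

Section pieces.
Context {R : realType} {n : nat} {f : 'rV[R]_n -> R} {C : R}.
Hypothesis C0 : 0 < C.
Hypothesis lip_f : forall x y, `|f x - f y| <= C * `|x - y|.
Hypothesis dd_f : directionally_differentiable f.
Implicit Types (x v w b : 'rV[R]_n) (V : {vspace 'rV[R]_n}).
Local Notation g := (ddir f).

(* [(b, q, m)] stands for the test direction [b], the value [q] with
   [|f'(x; b) - q| < 1 / (m + 1)], and the tolerance [1 / (m + 1)]. *)
Let test : Type := ('rV[rat]_n * rat * nat)%type.
Let dir (i : test) : 'rV[R]_n := map_mx ratr i.1.1.
Let value (i : test) : R := ratr i.1.2.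
Let tol (i : test) : R := i.2.+1%:R^-1.

(** The index is a finite list of rational tests and a scale, so there are countably many pieces.
    The subspace [V] may vary with the point; the list and the scale may not. The factor 4 is that
    of [second_difference_bound]. *)
Let piece (k : nat) (sN : seq test * nat) : set 'rV[R]_n :=
  [set x | (forall i t, i \in sN.1 -> 0 < t < sN.2.+1%:R^-1 ->
              `|f (x + t *: dir i) - f x - t * value i| <= tol i * t) /\
     exists V, [/\ \dim V = k, forall v, v \in V -> additive_at (g x) v
       & forall w, (forall v, v \in V -> dotv v w = 0) -> `|w| = 1 ->
           exists2 i, i \in sN.1 & 4 * tol i < defect (g x) w (dir i)]].

Let tol_gt0 i : 0 < tol i. Proof. by rewrite invr_gt0. Qed.

Lemma defect_lipschitz x w b w' b' :
  defect (g x) w b <= defect (g x) w' b' + 2 * C * (`|w - w'| + `|b - b'|).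
Proof.
have gL := ddir_lipschitz lip_f dd_f x.
have H1 := gL (w + b) (w' + b'); have H2 := gL w w'; have H3 := gL b b'.
have H4 : `|w + b - (w' + b')| <= `|w - w'| + `|b - b'|.
  by rewrite opprD addrACA ler_normD.
have H5 := ler_wpM2l (ltW C0) H4.
rewrite /defect.
have -> : g x (w + b) - g x w - g x b = (g x (w' + b') - g x w' - g x b')
  + (g x (w + b) - g x (w' + b') - (g x w - g x w') - (g x b - g x b')) by ring.
apply: le_trans (ler_normD _ _) _; rewrite lerD2l.
apply: le_trans (ler_normB _ _) _; apply: le_trans (lerD (ler_normB _ _) (lexx _)) _.
lra.
Qed.

Lemma gamma_piece x k : gamma f x = k -> (k < n)%N -> exists sN, piece k sN x.
Proof.
move=> gk kn; have [V [dV Vadd Vmax]] := gamma_eq_subspace C0 lip_f dd_f x k gk kn.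
pose good (i : test) := `|g x (dir i) - value i| < tol i.
pose S := [set w | `|w| = 1 /\ forall v, v \in V -> dotv v w = 0].
have cS : compact S.
  apply: bounded_closed_compact.
    by exists 1; split; [exact: num_real|move=> M M1 w [w1 _] /=; rewrite w1 ltW].
  have -> : S = [set w | `|w| - 1 = 0] `&` \bigcap_(v in [set v | v \in V]) [set w | dotv v w = 0].
    apply/seteqP; split=> w [/= w1 wV]; split=> //; first by rewrite w1 subrr.
    by apply/eqP; rewrite -subr_eq0 w1.
  apply: closedI.
    apply: closed_eq0; apply: (@lipschitz_continuous _ _ _ 1) => u v.
    by rewrite opprB addrA subrK mul1r ler_dist_dist.
  apply: closed_bigI => v _; apply: closed_eq0.
  apply: (@lipschitz_continuous _ _ _ (\sum_i `|v 0 i|)) => u w.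
  rewrite -sumrB mulr_suml; apply: le_trans (ler_norm_sum _ _ _) _.
  apply: ler_sum => i _; rewrite -mulrBr normrM ler_wpM2l //.
  by have := coord_le_norm (u - w) i; rewrite !mxE.
(* [P N] grows with [N] and involves finitely many tests; compactness of [S] gives one [N] for all
   [w]. *)
pose P (N : nat) w :=
  exists i : test, [/\ (pickle i < N)%N, good i & 4 * tol i < defect (g x) w (dir i)].
have [N _ SN] : \forall N \near \oo, S `<=` P N.
  apply: ((compact_near_coveringP _).1 cS nat \oo P) => w [w1 wV].
  have [b wb] : exists b, 0 < defect (g x) w b.
    apply: contrapT => /forallNP wb.
    have w0 : w = 0.
      apply: Vmax => // b; apply/eqP; rewrite -subr_eq0 opprD addrA -normr_le0.
      by rewrite leNgt; apply/negP/wb.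
    by move: w1; rewrite w0 normr0 => /eqP; rewrite eq_sym oner_eq0.
  set d := defect (g x) w b in wb.
  (* Moving [w] and [b] by at most [d / (8 * C)] each changes the defect by at most [d / 2]; the
     rest still exceeds [4 * tol i], as the tolerance is below [d / 8]. *)
  have e0 : 0 < d / (8 * C) by rewrite divr_gt0 // mulr_gt0.
  have [B bB] := rat_row_approx _ _ b _ e0.
  have [m m_lt] : exists m : nat, m.+1%:R^-1 < d / 8.
    have [m _ Hm] := near_infty_natSinv_lt (PosNum (divr_gt0 wb (ltr0n _ 8 : 0 < 8 :> R))).
    by exists m; exact: Hm m (leqnn m).
  have m0 : 0 < m.+1%:R^-1 :> R by rewrite invr_gt0.
  have [|q] := @rat_in_itvoo R
      (g x (map_mx ratr B) - m.+1%:R^-1) (g x (map_mx ratr B) + m.+1%:R^-1).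
    by rewrite ltrD2l; apply: lt_trans m0; rewrite oppr_lt0.
  rewrite in_itv /= => /andP[q1 q2].
  pose i : test := (B, q, m).
  have gi : good i by rewrite /good ltr_distlC; apply/andP; split.
  near=> w' N => /=; exists i; split => //; first by near: N; exact: nbhs_infty_gt.
  have ww' : `|w - w'| <= d / (8 * C).
    near: w'; apply/nbhs_ballP; exists (d / (8 * C)) => //.
    by move=> v; rewrite -ball_normE => /ltW.
  have dA := defect_lipschitz x w b w' (dir i).
  have dX : 2 * C * (`|w - w'| + `|b - dir i|) <= d / 2.
    apply: (@le_trans _ _ (2 * C * (d / (8 * C) + d / (8 * C)))).
      by rewrite ler_wpM2l ?lerD // mulr_ge0 // ltW.
    by rewrite le_eqVlt; apply/orP; left; apply/eqP; field; rewrite gt_eqF.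
  have arith (D A X T : R) : D <= A + X -> X <= D / 2 -> T < D / 8 -> 4 * T < A by lra.
  exact: (arith _ _ _ _ dA dX m_lt).
pose s := [seq i <- pmap (@unpickle test) (iota 0 N) | `[< good i >]].
have near_good i : i \in s ->
    \forall t \near 0^'+, `|f (x + t *: dir i) - f x - t * value i| <= tol i * t.
  rewrite mem_filter => /andP[/asboolP gi _].
  (* The strict inequality in [good] leaves room for the error of the difference quotient. *)
  have e0 : 0 < tol i - `|g x (dir i) - value i| by rewrite subr_gt0.
  have Hi := @near_ddir _ _ _ dd_f x (dir i) _ e0.
  near=> t.
  have t0 : 0 < t by near: t; exact: nbhs_right_gt.
  have Ht : `|f (x + t *: dir i) - f x - t * g x (dir i)| <=
      (tol i - `|g x (dir i) - value i|) * t by near: t; exact: Hi.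
  have -> : f (x + t *: dir i) - f x - t * value i =
    (f (x + t *: dir i) - f x - t * g x (dir i)) + t * (g x (dir i) - value i) by ring.
  apply: le_trans (ler_normD _ _) _; rewrite normrM (gtr0_norm t0).
  by apply: le_trans (lerD Ht (lexx _)) _; lra.
have [d d0 Hd] := (near_at_right0 _).1 (near_seq_all _ _ _ _ _ _ near_good).
have [M _ HM] := near_infty_natSinv_lt (PosNum d0).
exists (s, M); split => /= [i t si /andP[t0 tM]|].
  by apply: (Hd t _ i si); rewrite t0 (lt_trans tM) // (HM M (leqnn M)).
exists V; split => // w wV w1.
have [|i [iN gi wi]] := SN N (leqnn N) w; first by split.
exists i => //; rewrite mem_filter; apply/andP; split; first exact/asboolP.
by rewrite mem_pmap; apply/mapP; exists (pickle i); rewrite ?mem_iota ?pickleK.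
Unshelve. all: by end_near. Qed.

Lemma piece_tangential k sN : tangential k (piece k sN).
Proof.
case: sN => s N x [/= Hx [V [dV Vadd Vdef]]]; exists V; split => // h p q h0 Eh h_cvg hpq.
(* Small steps with [q i] nonzero and [|p i|] at most [K * |q i|] cannot stay in the piece. *)
have key (K : R) : 0 < K -> exists2 d, 0 < d & forall i,
    `|p i| <= K * `|q i| -> 0 < `|q i| < d -> False.
  move=> K0.
  have near_s (j : test) : j \in s -> \forall t \near 0^'+, forall v, `|v| <= K + 1 + `|dir j| ->
      `|f (x + t *: v) - f x - t * g x v| <= tol j / 2 * t.
    move=> _; have tj : 0 < tol j / 2 by rewrite divr_gt0.
    exact: (near_ddir_uniform C0 lip_f dd_f x _ _ tj).
  have [d d0 Hd] := (near_at_right0 _).1 (near_seq_all _ _ _ _ _ _ near_s).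
  exists (Num.min d N.+1%:R^-1) => [|i pq]; first by rewrite lt_min d0 invr_gt0 ltr0Sn.
  move=> /andP[t0]; rewrite lt_min => /andP[td tN].
  have [pV qV hE] := hpq i.
  set t := `|q i| in t0 td tN pq.
  (* Rescaling by [t = |q i|] gives a unit [w1] orthogonal to [V], detected by some test [j], and
     [u1] in [V] bounded by [K]. *)
  pose u1 := t^-1 *: p i; pose w1 := t^-1 *: q i.
  have u1K : `|u1| <= K by rewrite normrZ gtr0_norm ?invr_gt0 // mulrC ler_pdivrMr.
  have w11 : `|w1| = 1 by rewrite normrZ gtr0_norm ?invr_gt0 // mulVf // gt_eqF.
  have hE' : h i = t *: (u1 + w1) by rewrite hE scalerDr !scalerA divff ?gt_eqF // !scale1r.
  have [|j sj] := Vdef w1 _ w11; first by move=> v vV; rewrite dotvZr qV ?mulr0.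
  have td' : 0 < t < d by rewrite t0.
  have tN' : 0 < t < N.+1%:R^-1 by rewrite t0.
  have uw : `|u1 + w1| <= K + 1 by rewrite (le_trans (ler_normD _ _)) // w11 lerD2r.
  have H1 : `|f (x + t *: (u1 + w1)) - f x - t * g x (u1 + w1)| <= tol j / 2 * t.
    by apply: (Hd t td' j sj); rewrite (le_trans uw) // lerDl.
  have H2 : `|f (x + t *: (u1 + w1 + dir j)) - f x - t * g x (u1 + w1 + dir j)| <= tol j / 2 * t.
    by apply: (Hd t td' j sj); rewrite (le_trans (ler_normD _ _)) // lerD2r.
  have H3 : `|f (x + t *: dir j) - f x - t * g x (dir j)| <= tol j / 2 * t.
    by apply: (Hd t td' j sj); rewrite lerDr addr_ge0 // ltW.
  (* The same test value is valid at [x] and, by [Eh i], at [x + h i]. *)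
  have H4 := Hx j t sj tN'.
  have [/= /(_ j t sj tN') + _] := Eh i.
  rewrite hE' -(addrA x) -(scalerDr t _ (dir j)) => H5.
  rewrite ltNge => /negP; apply.
  rewrite -(ler_pM2l t0) /defect -{1}(gtr0_norm t0) -normrM.
  (* Additivity at [u1] removes it from the defect, so the bound for [u1 + w1] contradicts the
     margin at [w1]. *)
  have u1V : additive_at (g x) u1 by apply: Vadd; rewrite memvZ.
  have -> : t * (g x (w1 + dir j) - g x w1 - g x (dir j)) =
    t * (g x (u1 + w1 + dir j) - g x (u1 + w1) - g x (dir j)).
    by rewrite -(addrA u1) !u1V opprD addrACA subrr add0r.
  exact: second_difference_bound (tol_gt0 j) t0 H1 H2 H3 H4 H5.
have slope_small (e : R) : 0 < e -> \forall i \near \oo, p i != 0 /\ enorm (q i) <= e * enorm (p i).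
  move=> e0.
  have n0 : 0 < n%:R + 1 :> R by rewrite ltr_wpDl.
  (* If [enorm (q i) > e * enorm (p i)], comparing the norms gives
     [|p i| <= (n + 1) / e * |q i|]. *)
  have [d d0 Hd] := key ((n%:R + 1) / e) (divr_gt0 n0 e0).
  have dn : 0 < d / (n%:R + 1) by rewrite divr_gt0.
  have hd : \forall i \near \oo, `|h i| < d / (n%:R + 1).
    have /cvgrPdist_lt /(_ _ dn) := h_cvg.
    by apply: filterS => i; rewrite sub0r normrN.
  apply: filterS hd => i hid; have [pV qV hE] := hpq i.
  have qd : `|q i| < d.
    apply: le_lt_trans (norm_le_enorm _) _.
    apply: (@le_lt_trans _ _ (enorm (h i))); first by rewrite hE enorm_orthogonal_le ?qV.
    apply: le_lt_trans (enorm_le_norm _) _.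
    apply: (@le_lt_trans _ _ ((n%:R + 1) * `|h i|)); first by rewrite ler_wpM2r // lerDl.
    by rewrite mulrC -ltr_pdivlMr.
  have [//|bad] := pselect (p i != 0 /\ enorm (q i) <= e * enorm (p i)).
  exfalso; apply: (Hd i).
    apply: le_trans (norm_le_enorm _) _; rewrite mulrAC ler_pdivlMr // mulrC.
    apply: (@le_trans _ _ (enorm (q i))); last first.
      by apply: le_trans (enorm_le_norm _) _; rewrite ler_wpM2r // lerDl.
    have [->|p0] := eqVneq (p i) 0.
      by rewrite enorm0 mulr0 enorm_ge0.
    by apply: ltW; rewrite ltNge; apply/negP => qp; apply: bad.
  (* If [q i = 0], then [p i = h i] is nonzero and the desired bound is trivial. *)
  rewrite qd andbT normr_gt0; apply: contra_notN bad => /eqP q0; split.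
    by have := h0 i; rewrite hE q0 addr0.
  by rewrite q0 enorm0 mulr_ge0 ?enorm_ge0 // ltW.
apply/fine_cvgP; split.
  by apply: filterS (slope_small 1 ltr01) => i [p0 _]; rewrite /slope (negbTE p0).
apply/cvgrPdist_le => e e0; apply: filterS (slope_small e e0) => i [p0 pq] /=.
rewrite /slope (negbTE p0) /= sub0r normrN ger0_norm ?divr_ge0 ?enorm_ge0 //.
by rewrite ler_pdivrMr // lt_def enorm_ge0 enorm_eq0 p0.
Qed.

(** Pieces are enumerated by the codes of their indices; a number coding nothing gets the empty set,
    vacuously tangential. *)
Lemma gamma_sigma_tangential k : (k < n)%N -> sigma_tangential k [set x | gamma f x = k].
Proof.
move=> kn.
exists (fun i => if unpickle i is Some sN then piece k sN else set0); split.
  by move=> i; case: (unpickle i) => [sN|]; [exact: piece_tangential|].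
move=> x /= gk; have [sN Hx] := gamma_piece x k gk kn.
by exists (pickle sN) => //; rewrite pickleK.
Qed.

End pieces.

Theorem theorem2p6 (R : realType) (n k : nat) (f : 'rV[R]_n -> R)
    (dd_f : directionally_differentiable f) (lip_f : lipschitz_euclidean f)
    (lt_kn : (k < n)%N) :
  sigma_tangential k [set x | gamma f x = k].
Proof.
have [C HC] := lip_f.
(* A sup-norm Lipschitz constant, positive even if [C] is not: [|C| + 1] bounds [C], and [n + 1]
   bounds the norm ratio. *)
have C1 : 0 < (`|C| + 1) * (n%:R + 1) by rewrite mulr_gt0 // ltr_wpDl.
apply: (gamma_sigma_tangential C1) => // x y; apply: le_trans (HC x y) _.
apply: (@le_trans _ _ ((`|C| + 1) * enorm (x - y))).
  by rewrite ler_wpM2r ?enorm_ge0 // (le_trans (ler_norm C)) // lerDl.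
rewrite -mulrA ler_wpM2l ?addr_ge0 // (le_trans (enorm_le_norm _)) //.
by rewrite ler_wpM2r // lerDl.
Qed.
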